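(* Let $(A,\Phi,V,H)$ be a $C^*$-Eberlein algebra with $A$ unital. Let $M\in A^*$ be a left invariant mean. Then $M$ is the unique left invariant mean on $A$, and $(M\otimes\mathrm{id})(V)\in\mathcal B(H)$ is the orthogonal projection onto $\operatorname{Inv}(V)$. If $V$ is unitary, then $M$ is also right invariant.
   Context: For a $C^*$-algebra $A$, $A^{**}$ is its bidual von Neumann algebra and $\overline\otimes$ is the von Neumann algebra tensor product. For $V\in A^{**}\overline\otimes\mathcal B(H)$, $\mu\in A^*$, $\omega\in\mathcal B(H)_*$ write $(\mu\otimes\mathrm{id})(V)\in\mathcal B(H)$ and $(\mathrm{id}\otimes\omega)(V)\in A^{**}$ for the slices. A $C^*$-Eberlein algebra is a quadruple $(A,\Phi,V,H)$ where: (1) $A$ is a $C^*$-algebra, $\Phi:A\to A^{**}\overline\otimes A^{**}$ is a unital $*$-homomorphism, $H$ is a Hilbert space and $V\in A^{**}\overline\otimes\mathcal B(H)$ is a contraction; (2) $A_V:=\{(\mathrm{id}\otimes\omega)(V):\omega\in\mathcal B(H)_*\}$ is a subset of $A\subseteq A^{**}$ and is norm dense in $A$; (3) the bilinear product on $A^*$ given by $\langle\mu\star\nu,a\rangle=\langle\Phi(a),\mu\otimes\nu\rangle$ is associative; (4) the map $A^*\to\mathcal B(H)$, $\mu\mapsto(\mu\otimes\mathrm{id})(V)$ is a homomorphism for $\star$. $A^{**}$ is an $A^*$-bimodule via $\langle x\cdot\mu,\lambda\rangle=\langle x,\mu\star\lambda\rangle$ and $\langle\mu\cdot x,\lambda\rangle=\langle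 x,\lambda\star\mu\rangle$, and $A$ is a sub-bimodule. A state $M\in A^*$ is a left invariant mean if $\langle M,a\cdot\mu\rangle=\langle M,a\rangle$ for all states $\mu\in A^*$ and all $a\in A$; it is right invariant if $\langle M,\mu\cdot a\rangle=\langle M,a\rangle$ for all such $\mu,a$. A vector $\xi\in H$ is invariant for $V$ if $(\mu\otimes\mathrm{id})(V)\xi=\langle\mu,1\rangle\xi$ for all $\mu\in A^*$; $\operatorname{Inv}(V)$ is the set of all invariant vectors. *)

(* Defs.v *)
From HB Require Import structures.
From mathcomp Require Import all_boot all_order all_algebra.
From mathcomp Require Import all_classical all_reals all_analysis.
From mathcomp Require Export complex.

Set Implicit Arguments.
Unset Strict Implicit.
Unset Printing Implicit Defensive.

Import Order.TTheory GRing.Theory Num.Theory.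
Import numFieldNormedType.Exports.

Local Open Scope classical_set_scope.
Local Open Scope ring_scope.

(* The scalar field is an arbitrary [C : numClosedFieldType] here; it is
   instantiated with [R[i]], [R : realType], in the theorem.  Norms take their
   values in [C]. *)

(* Inner products are linear in the first variable. *)
HB.mixin Record isHilbert (C : numClosedFieldType) H
    & CompleteNormedModule C H := {
  hdot : {dot H for (@Num.conj C)};
  hdot_norm : forall x : H, `|x| ^+ 2 = hdot x x
}.

#[short(type="hilbertType")]
HB.structure Definition Hilbert (C : numClosedFieldType) :=
  {H of CompleteNormedModule C H & isHilbert C H}.

Notation "''[' x , y ]" := (hdot x%R y%R) : ring_scope.

(* Unital C*-algebras.  The ring operations are declared here because the
   library has no structure joining normed modules and rings below number
   domains, so that [GRing.Algebra] cannot be inherited. *)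
HB.mixin Record isCStarAlg (C : numClosedFieldType) A
    & CompleteNormedModule C A := {
  cone : A;
  cmul : A -> A -> A;
  star : A -> A;
  cmulA : forall a b d : A, cmul a (cmul b d) = cmul (cmul a b) d;
  cmul1l : forall a : A, cmul cone a = a;
  cmul1r : forall a : A, cmul a cone = a;
  cmul_linearl : forall b : A, linear (fun a : A => cmul a b);
  cmul_linearr : forall a : A, linear (cmul a);
  star_antilinear : forall (c : C) (a b : A),
    star (c *: a + b) = Num.conj c *: star a + star b;
  starK : forall a : A, star (star a) = a;
  starM : forall a b : A, star (cmul a b) = cmul (star b) (star a);
  norm_submult : forall a b : A, `|cmul a b| <= `|a| * `|b|;
  cstar_identity : forall a : A, `|cmul (star a) a| = `|a| ^+ 2
}.

#[short(type="cstarAlgType")]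
HB.structure Definition CStarAlg (C : numClosedFieldType) :=
  {A of CompleteNormedModule C A & isCStarAlg C A}.

Section Operators.
Context {C : numClosedFieldType}.

Definition norm_le {U W : normedModType C} (f : U -> W) (c : C) : Prop :=
  0 <= c /\ forall x, `|f x| <= c * `|x|.

Definition bounded_linear {U W : normedModType C} (f : U -> W) : Prop :=
  linear f /\ exists c, norm_le f c.

Definition dual (U : normedModType C) : set (U -> C) :=
  [set mu | bounded_linear mu].

Definition BL (H : hilbertType C) : set (H -> H) := [set T | bounded_linear T].

Definition is_adjoint {H : hilbertType C} (T S : H -> H) : Prop :=
  forall x y, '[T x, y] = '[x, S y].

Definition unitary {H : hilbertType C} (T : H -> H) : Prop :=
  bounded_linear T /\
  exists S, [/\ is_adjoint T S, S \o T = id & T \o S = id].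

Definition orthogonal_projection_onto {H : hilbertType C}
    (P : H -> H) (E : set H) : Prop :=
  [/\ bounded_linear P, P \o P = P, is_adjoint P P & range P = E].

(* The bounded operator with the given sesquilinear form (it is unique when it
   exists). *)
Definition op_of_form {H : hilbertType C} (B : H -> H -> C) : H -> H :=
  xget (fun=> 0) [set T | bounded_linear T /\ forall x y, '[T x, y] = B x y].

Definition commutant {H : hilbertType C} (S : set (H -> H)) : set (H -> H) :=
  [set T | BL T /\ forall X, S X -> T \o X = X \o T].

(* The von Neumann algebra generated by a set of bounded operators which is
   stable under adjoints; it is only used for such sets. *)
Definition vN_gen {H : hilbertType C} (S : set (H -> H)) : set (H -> H) :=
  commutant (commutant S).

Definition square_summable {H : hilbertType C} (x : nat -> H) : Prop :=
  exists c : C, forall n, \sum_(i < n) `|x i| ^+ 2 <= c.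

(* Membership in the predual B(H)_*: functionals
   T |-> \sum_n <T x_n, y_n> with (x_n), (y_n) square summable.  Only the
   values on bounded operators are meaningful.  The predual of a von Neumann
   algebra N on H consists of the restrictions of these functionals to N. *)
Definition normal {H : hilbertType C} (w : (H -> H) -> C) : Prop :=
  exists x y : nat -> H, [/\ square_summable x, square_summable y &
    forall T, BL T -> series (fun n => '[T (x n), y n]) @ \oo --> w T].

End Operators.

Arguments dual {C} U.
Arguments BL {C} H.

(* Hilbert space tensor product: it is determined, up to a unique unitary
   compatible with [ht_map], by the following data. *)
Record hilbert_tensor (C : numClosedFieldType) (K H : hilbertType C) := {
  ht_space :> hilbertType C;
  ht_map : K -> H -> ht_space;
  ht_linearl : forall h, linear (fun k => ht_map k h);
  ht_linearr : forall k, linear (ht_map k);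
  ht_dot : forall k k' h h',
    '[ht_map k h, ht_map k' h'] = '[k, k'] * '[h, h'];
  ht_dense : dense [set t | exists n (k : 'I_n -> K) (h : 'I_n -> H),
                              t = \sum_(i < n) ht_map (k i) (h i)]
}.

Arguments ht_map {C K H h} _ _ : rename.

Section Tensor.
Context {C : numClosedFieldType} {K H : hilbertType C}.
Variable T : hilbert_tensor K H.

(* The von Neumann algebra tensor product of N on K and P on H, on T. *)
Definition vN_tensor (N : set (K -> K)) (P : set (H -> H)) : set (T -> T) :=
  vN_gen [set W : T -> T | bounded_linear W /\ exists x y, [/\ N x, P y &
            forall k h, W (ht_map k h) = ht_map (x k) (y h)]].

(* (w_(k,k') (x) id)(V) and (id (x) w_(h,h'))(V) for the vector functionals
   w_(k,k') = <. k, k'> and w_(h,h') = <. h, h'>. *)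
Definition vec_slice_l (V : T -> T) (k k' : K) : H -> H :=
  op_of_form (fun h h' => '[V (ht_map k h), ht_map k' h']).

Definition vec_slice_r (V : T -> T) (h h' : H) : K -> K :=
  op_of_form (fun k k' => '[V (ht_map k h), ht_map k' h']).

(* (w (x) id)(V), for w a normal functional on B(K), and (id (x) w)(V), for w a
   normal functional on B(H). *)
Definition slice_l (w : (K -> K) -> C) (V : T -> T) : H -> H :=
  op_of_form (fun h h' => w (vec_slice_r V h h')).

Definition slice_r (w : (H -> H) -> C) (V : T -> T) : K -> K :=
  op_of_form (fun k k' => w (vec_slice_l V k k')).

End Tensor.

(* A realisation on a Hilbert space of the bidual von Neumann algebra of A: a
   unital *-representation such that restriction of functionals is an isometric
   isomorphism from the predual of N, the von Neumann algebra generated by the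
   image of A, onto A^*.  Its adjoint is the identification of A^** with N,
   under which the canonical embedding of A into A^** is the representation.
   (The universal representation of A has these properties.)  The restriction
   map is contractive in any case, so that being isometric is [bd_isometric]. *)
Record bidual_vN (C : numClosedFieldType) (A : cstarAlgType C) := {
  bd_space :> hilbertType C;
  bd_rep : A -> bd_space -> bd_space;
  bd_bounded : forall a, bounded_linear (bd_rep a);
  bd_linear : forall c a b x,
    bd_rep (c *: a + b) x = c *: bd_rep a x + bd_rep b x;
  bd_1 : bd_rep cone = id;
  bd_M : forall a b, bd_rep (cmul a b) = bd_rep a \o bd_rep b;
  bd_star : forall a, is_adjoint (bd_rep a) (bd_rep (star a));
  bd_onto : forall mu, dual A mu ->
    exists2 w, normal w & forall a, w (bd_rep a) = mu a;
  bd_isometric : forall w, normal w ->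
    forall c, norm_le (fun a => w (bd_rep a)) c ->
    forall X b, vN_gen (range bd_rep) X -> norm_le X b -> `|w X| <= c * b
}.

Arguments bd_rep {C A b} _ _ : rename.

Section Bidual.
Context {C : numClosedFieldType} {A : cstarAlgType C}.

(* A^** as a set of operators. *)
Definition bd_alg (B : bidual_vN A) : set (B -> B) := vN_gen (range bd_rep).

(* A normal functional which extends mu in A^* to A^**; its values on
   [bd_alg B] are uniquely determined. *)
Definition bd_ext (B : bidual_vN A) (mu : A -> C) : (B -> B) -> C :=
  xget (fun=> 0) [set w | normal w /\ forall a, w (bd_rep a) = mu a].

Definition state (mu : A -> C) : Prop :=
  [/\ dual A mu, forall a, 0 <= mu (cmul (star a) a) & mu cone = 1].

(* <X, mu (x) nu>, for X in A^** (x) A^**. *)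
Definition pair_tensor (B : bidual_vN A) (T : hilbert_tensor B B)
    (X : T -> T) (mu nu : A -> C) : C :=
  bd_ext mu (slice_r (bd_ext nu) X).

(* The product on A^* defined by Phi. *)
Definition conv (B : bidual_vN A) (T : hilbert_tensor B B)
    (Phi : A -> T -> T) (mu nu : A -> C) : A -> C :=
  fun a => pair_tensor (Phi a) mu nu.

(* (mu (x) id)(V), for mu in A^*. *)
Definition mu_slice (B : bidual_vN A) (H : hilbertType C)
    (T : hilbert_tensor B H) (V : T -> T) (mu : A -> C) : H -> H :=
  slice_l (bd_ext mu) V.

End Bidual.

Arguments bd_alg {C A} B _.

(* Both Hilbert space tensor products and the realisation of A^** are
   arbitrary; they are unique up to isomorphism. *)
Record cstar_eberlein (C : numClosedFieldType) (A : cstarAlgType C)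
    (H : hilbertType C) (B : bidual_vN A)
    (T2 : hilbert_tensor B B) (T : hilbert_tensor B H)
    (Phi : A -> T2 -> T2) (V : T -> T) : Prop := {
  Phi_in : forall a, vN_tensor (bd_alg B) (bd_alg B) (Phi a);
  Phi_linear : forall c a b x, Phi (c *: a + b) x = c *: Phi a x + Phi b x;
  Phi_1 : Phi cone = id;
  Phi_M : forall a b, Phi (cmul a b) = Phi a \o Phi b;
  Phi_star : forall a, is_adjoint (Phi a) (Phi (star a));
  V_in : vN_tensor (bd_alg B) (BL H) V;
  V_contraction : norm_le V 1;
  AV_sub : forall w : (H -> H) -> C, normal w ->
    exists a, bd_rep a = slice_r w V;
  AV_dense : dense [set a : A | exists2 w : (H -> H) -> C,
                                  normal w & bd_rep a = slice_r w V];
  conv_assoc : forall mu nu la, dual A mu -> dual A nu -> dual A la ->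
    conv Phi (conv Phi mu nu) la = conv Phi mu (conv Phi nu la);
  V_hom : forall mu nu, dual A mu -> dual A nu ->
    mu_slice V (conv Phi mu nu) = mu_slice V mu \o mu_slice V nu
}.

Section Means.
Context {C : numClosedFieldType} {A : cstarAlgType C} {B : bidual_vN A}.
Context {T2 : hilbert_tensor B B}.
Variable Phi : A -> T2 -> T2.

(* For the bimodule structure, elements of A^** are viewed as functionals on
   A^*, and A embeds in A^** by evaluation: <la, a> = [bd_ev a la]. *)
Definition bd_ev (a : A) : (A -> C) -> C := fun la => la a.

(* x . mu *)
Definition act_r (x : (A -> C) -> C) (mu : A -> C) : (A -> C) -> C :=
  fun la => x (conv Phi mu la).

(* mu . x *)
Definition act_l (mu : A -> C) (x : (A -> C) -> C) : (A -> C) -> C :=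
  fun la => x (conv Phi la mu).

Definition left_invariant_mean (M : A -> C) : Prop :=
  state M /\
  forall mu a, state mu -> act_r (bd_ev a) mu M = bd_ev a M.

Definition right_invariant_mean (M : A -> C) : Prop :=
  state M /\
  forall mu a, state mu -> act_l mu (bd_ev a) M = bd_ev a M.

End Means.

Definition invariant_vectors (C : numClosedFieldType) (A : cstarAlgType C)
    (B : bidual_vN A) (H : hilbertType C) (T : hilbert_tensor B H)
    (V : T -> T) : set H :=
  [set xi | forall mu, dual A mu -> mu_slice V mu xi = mu cone *: xi].

(* Main.v *)
(* Write U_mu for the slice (mu (x) id)(V) and P for U_M.  Left invariance
   against the vector states of A, together with the multiplicativity of
   mu |-> U_mu and polarization, shows that V fixes k (x) P h for all k and h;
   the vectors xi such that V fixes every k (x) xi are exactly the invariant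
   ones.  As V is a contraction, its adjoint fixes these tensors too, so that
   <U_mu h, xi> = mu(1) <h, xi> for xi invariant: hence P is self-adjoint, it is
   the projection onto Inv(V), and P U_mu = mu(1) P.  Finally mu is determined by
   U_mu because A_V is dense, which gives uniqueness and, applied to M * mu,
   right invariance; M * mu is bounded because unital *-homomorphisms of
   C*-algebras are contractive. *)

Require Import Defs.
From HB Require Import structures.
From mathcomp Require Import all_boot all_order all_algebra.
From mathcomp Require Import all_classical all_reals all_analysis.
From mathcomp Require Import complex ring.

Import Order.TTheory GRing.Theory Num.Theory.
Import numFieldNormedType.Exports.
Local Open Scope classical_set_scope.
Local Open Scope ring_scope.

(* The order-completeness of R, stated inside the complex field so that the
   topology and order of R are never needed below. *)
Definition near_minima (C : numClosedFieldType) : Prop :=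
  forall (X : Type) (F : X -> C) (e : C),
    inhabited X -> (forall x, 0 <= F x) -> 0 < e ->
    exists x, forall y, F x <= F y + e.

Lemma complex_near_minima (R : realType) : near_minima R[i].
Proof.
move=> X F e [x0] F0 e0.
(* Nonnegative elements of [R[i]] have zero imaginary part, so the infimum can be taken among real
   parts. *)
have ReF x : F x = (complex.Re (F x))%:C%C.
  by have := F0 x; case: (F x) => a b; rewrite lecE /= => /andP[/eqP->].
have Ree : e = (complex.Re e)%:C%C.
  by have := e0; case: (e) => a b; rewrite ltcE /= => /andP[/eqP->].
have E0 : 0 < complex.Re e by move: e0; rewrite Ree ltcE /= eqxx.
have infF : has_inf (range ((fun x => complex.Re (F x)) : X -> R)).
  split; first by exists (complex.Re (F x0)), x0.
  exists 0 => _ [x _ <-] /=.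
  by have := F0 x; rewrite lecE => /andP[].
have [_ [x _ <-] lt_x] := inf_adherent E0 infF.
exists x => y; rewrite ReF (ReF y) Ree -rmorphD lecR /=.
apply: le_trans (ltW lt_x) _; rewrite lerD2r.
by apply: ge_inf; [exact: infF.2|exists y].
Qed.

(** * Completeness through nested approximations *)

Section CompleteFilter.
Context {C : numFieldType} {W : completeNormedModType C}.

(* Approximants indexed by the scalars [e > 0]: the scalar field need not have
   a sequence tending to 0. *)
Lemma complete_approx (S : C -> set W) (c : C) :
  0 < c ->
  (forall e, 0 < e -> S e !=set0) ->
  (forall e x y, 0 < e -> S e x -> S e y -> `|x - y| <= c * e) ->
  (forall e e', 0 < e -> e <= e' -> S e `<=` S e') ->
  exists y, forall e, 0 < e -> exists2 x, S e x & `|y - x| <= e.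
Proof.
move=> c0 S0 Sd Sm.
pose F := filter_from [set e : C | 0 < e] S.
have FF : ProperFilter F.
  apply: filter_from_proper; last by move=> e /= /S0.
  apply: filter_from_filter; first by exists 1 => /=.
  move=> e e' /= e0 e'0.
  have : e >=< e' by apply: real_comparable; rewrite gtr0_real.
  case/orP => [le_ee'|le_e'e].
    by exists e => // x Sx; split => //; exact: Sm Sx.
  by exists e' => // x Sx; split => //; exact: Sm Sx.
have Fc : cauchy F.
  apply: cauchy_exP => e e0.
  have d0 : 0 < e / (2 * c) by rewrite divr_gt0 // mulr_gt0.
  have [x Sx] := S0 _ d0.
  exists x, (e / (2 * c)) => // y Sy; rewrite -ball_normE /=.
  apply: le_lt_trans (Sd _ _ _ d0 Sx Sy) _.
  have -> : c * (e / (2 * c)) = e / 2 by field; rewrite gt_eqF.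
  by rewrite ltr_pdivrMr // ltr_pMr // ltr1n.
have /cauchy_cvgP Fcvg := Fc.
exists (lim F) => e e0.
have : F (ball (lim F) e) by apply: Fcvg; exact: nbhsx_ballx.
case=> d /= d0 Sd_sub.
have [le_de|le_ed] : d <= e \/ e <= d.
- by apply/orP; apply: real_comparable; rewrite gtr0_real.
- have [x Sx] := S0 _ d0; exists x; first exact: Sm Sx.
  by have := Sd_sub _ Sx; rewrite -ball_normE => /ltW.
- have [x Sx] := S0 _ e0; exists x => //.
  by have := Sd_sub _ (Sm _ _ e0 le_ed _ Sx); rewrite -ball_normE => /ltW.
Qed.

End CompleteFilter.

(** * Hilbert spaces *)

Lemma le0_eps {C : numFieldType} (x k : C) :
  0 <= k -> (forall e, 0 < e -> x <= k * e) -> x <= 0.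
Proof.
move=> k0 xk; apply/ler_addgt0Pr => e e0; rewrite add0r.
have k1 : 0 < k + 1 by rewrite ltr_wpDl.
apply: le_trans (xk (e / (k + 1)) _) _; first by rewrite divr_gt0.
by rewrite mulrCA ger_pMr // ler_pdivrMr // mul1r lerDl.
Qed.

Lemma add_conj_le {C : numClosedFieldType} (z : C) : z + z^* <= 2 * `|z|.
Proof.
have zR : z + z^* \is Num.real by apply/CrealP; rewrite rmorphD /= conjCK addrC.
apply: le_trans (real_ler_norm zR) _; apply: le_trans (ler_normD _ _) _.
by rewrite norm_conjC mulr_natl mulr2n.
Qed.

(** The value [t = - d^* / Z] minimises the quadratic and gives the bound. Cauchy-Schwarz, the Riesz
    estimate and the adjoint fixed-point property of contractions all reduce to it. *)
Lemma quadratic_discriminant {C : numClosedFieldType} (e d Z : C) :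
  0 <= Z ->
  (forall t, 0 <= e + (t * d + (t * d)^*) + `|t| ^+ 2 * Z) ->
  `|d| ^+ 2 <= e * Z.
Proof.
move=> Z0 quad.
have [->|d0] := eqVneq d 0.
  rewrite normr0 expr0n /= mulr_ge0 //.
  by have := quad 0; rewrite normr0 !mul0r conjC0 expr0n /= mul0r !addr0.
have e0 : 0 <= e by have := quad 0; rewrite normr0 !mul0r conjC0 expr0n /= mul0r !addr0.
have [Zz|Zn0] := eqVneq Z 0.
  (* With [Z = 0] this [t] turns the expression into [- (e + 2)], which is negative. *)
  have := quad (- (e + 1) / d); rewrite Zz mulr0 addr0 mulfVK // conj_Creal.
    have -> : e + (- (e + 1) + - (e + 1)) = - (e + 2) by ring.
    by rewrite oppr_ge0 => /(lt_le_trans (ltr_wpDl e0 (ltr0Sn C 1))); rewrite ltxx.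
  by rewrite rpredN rpredD // ger0_real.
have Zp : 0 < Z by rewrite lt_def Zn0.
have := quad (- d^* / Z).
have dd : - d^* / Z * d = - (`|d| ^+ 2 / Z) by rewrite normCK; ring.
have dr : `|d| ^+ 2 / Z \is Num.real by rewrite ger0_real // divr_ge0 // exprn_ge0.
rewrite dd conj_Creal ?rpredN // normrM normrN norm_conjC normfV (ger0_norm Z0).
have -> : e + (- (`|d| ^+ 2 / Z) - `|d| ^+ 2 / Z) + (`|d| / Z) ^+ 2 * Z
    = e - `|d| ^+ 2 / Z by field.
by rewrite subr_ge0 ler_pdivrMr.
Qed.

Section HilbertSpace.
Context {C : numClosedFieldType} {H : hilbertType C}.
Implicit Types x y z : H.

Lemma dotC x y : '[y, x] = ('[x, y])^*.
Proof. by rewrite (hermC hdot y x) expr0 mul1r. Qed.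

Lemma dotDl x y z : '[x + y, z] = '[x, z] + '[y, z].
Proof. exact: linearDl. Qed.

Lemma dotDr x y z : '[z, x + y] = '[z, x] + '[z, y].
Proof. exact: linearDr. Qed.

Lemma dotBl x y z : '[x - y, z] = '[x, z] - '[y, z].
Proof. exact: linearBl. Qed.

Lemma dotBr x y z : '[z, x - y] = '[z, x] - '[z, y].
Proof. exact: linearBr. Qed.

Lemma dotZl c x z : '[c *: x, z] = c * '[x, z].
Proof. exact: linearZl_LR. Qed.

Lemma dotZr c x z : '[z, c *: x] = c^* * '[z, x].
Proof. exact: linearZr_LR. Qed.

Lemma dot0l x : '[0, x] = 0.
Proof. exact: linear0l. Qed.

Lemma dot0r x : '[x, 0] = 0.
Proof. exact: linear0r. Qed.

Lemma dot_normD x y :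
  `|x + y| ^+ 2 = `|x| ^+ 2 + ('[y, x] + ('[y, x])^*) + `|y| ^+ 2.
Proof. by rewrite !hdot_norm dotDl !dotDr -(dotC y x); ring. Qed.

Lemma dot_cauchy_schwarz x y : `|'[x, y]| <= `|x| * `|y|.
Proof.
rewrite -ler_sqr ?nnegrE ?mulr_ge0 // mulrC exprMn.
apply: quadratic_discriminant => [|t]; first by rewrite exprn_ge0.
by rewrite -dotZl -exprMn -normrZ -dot_normD exprn_ge0.
Qed.

Lemma dot_ext x y : (forall z, '[x, z] = '[y, z]) -> x = y.
Proof.
move=> xy; apply/eqP; rewrite -subr_eq0 -normr_eq0 -sqrf_eq0 hdot_norm.
by rewrite dotBl xy subrr.
Qed.

(** Expanding on the diagonal at [c *: x + y], the choices [c = 1] and [c = 'i] give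
    [B x y = - B y x] and [B x y = B y x]. *)
Lemma dot_polarization (B : H -> H -> C) :
  (forall c x y z, B (c *: x + y) z = c * B x z + B y z) ->
  (forall c x y z, B z (c *: x + y) = c^* * B z x + B z y) ->
  (forall x, B x x = 0) -> forall x y, B x y = 0.
Proof.
move=> Bl Br B0 x y.
have Bp c : c * B x y + c^* * B y x = 0.
  have := B0 (c *: x + y); rewrite Bl !Br !B0 mulr0 add0r addr0 => <-.
  by ring.
have := Bp 1; rewrite conjC1 !mul1r => /eqP; rewrite addr_eq0 => /eqP xy.
have := Bp 'i; rewrite conjCi mulNr -mulrBr => /eqP.
rewrite mulf_eq0 (negPf (neq0Ci C)) /= xy -opprD oppr_eq0 -mulr2n mulrn_eq0 /=.
by move=> /eqP ->; rewrite oppr0.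
Qed.

Lemma op_ext (S T : H -> H) : (forall x y, '[S x, y] = '[T x, y]) -> S = T.
Proof. by move=> ST; apply/funext => x; exact: dot_ext. Qed.

Lemma op_of_formE (B : H -> H -> C) (T : H -> H) :
  bounded_linear T -> (forall x y, '[T x, y] = B x y) -> op_of_form B = T.
Proof.
move=> Tbl TB; apply: xget_unique => // S [_ SB].
by apply: op_ext => x y; rewrite SB TB.
Qed.

(** A representing vector minimises |x|^2 - 2 Re f(x). Near minimisers represent [f] up to a small
    error, and completeness turns them into an exact representative. *)
Lemma riesz (f : H -> C) (k : C) : near_minima C ->
  linear f -> norm_le f k -> exists y, forall x, f x = '[x, y].
Proof.
move=> minC fL [k0 fk].
have fZ t z x : f (x + t *: z) = f x + t * f z by rewrite addrC fL addrC.
pose S e := [set x : H | forall z, `|f z - '[z, x]| <= e * `|z|].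
have [||||y Sy] := @complete_approx C H S 2.
- by [].
- move=> e e0.
  (* The constant [k ^+ 2] makes [J] a sum of nonnegative terms, so that [near_minima] applies. *)
  pose J x := `|x| ^+ 2 - (f x + (f x)^*) + k ^+ 2.
  have J0 x : 0 <= J x.
    have := add_conj_le (f x); rewrite -subr_ge0 => h1.
    have h2 : 0 <= (`|x| - k) ^+ 2.
      by rewrite real_exprn_even_ge0 // rpredB // ger0_real.
    have h3 : 0 <= 2 * (k * `|x| - `|f x|) by rewrite mulr_ge0 // subr_ge0.
    have -> : J x = 2 * `|f x| - (f x + (f x)^*) + (`|x| - k) ^+ 2
        + 2 * (k * `|x| - `|f x|) by rewrite /J; ring.
    by apply: addr_ge0 => //; exact: addr_ge0.
  have [x Jx] := minC H J (e ^+ 2) (inhabits 0) J0 (exprn_gt0 2 e0).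
  have e1 := ltW e0.
  exists x => z; rewrite distrC -ler_sqr ?nnegrE ?mulr_ge0 // exprMn.
  (* Near minimality against [x + t *: z] is a nonnegative quadratic in [t] with constant term
     [e ^+ 2] and linear coefficient ['[z, x] - f z]. *)
  apply: quadratic_discriminant => [|t]; first by rewrite exprn_ge0.
  have := Jx (x + t *: z); rewrite -subr_ge0 /J dot_normD fZ.
  rewrite normrZ exprMn dotZl.
  by congr (is_true (0 <= _)); ring.
- move=> e x y e0 Sx Sy.
  have : `|x - y| * `|x - y| <= 2 * e * `|x - y|.
    rewrite -expr2 hdot_norm -[leLHS]ger0_norm ?dnorm_ge0 //.
    have -> : '[x - y, x - y] = (f (x - y) - '[x - y, y]) - (f (x - y) - '[x - y, x]).
      by rewrite dotBr; ring.
    apply: le_trans (ler_normB _ _) _.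
    by rewrite mulr_natl mulr2n mulrDl lerD.
  have [->|xy] := eqVneq x y; first by rewrite subrr normr0 mulr_ge0 // ltW.
  by rewrite ler_pM2r // normr_gt0 subr_eq0.
- by move=> e e' e0 ee' x Sx z; apply: le_trans (Sx z) _; rewrite ler_wpM2r.
exists y => z; apply/eqP; rewrite -subr_eq0 -normr_le0.
apply: (@le0_eps _ _ (2 * `|z|)) => [|e e0]; first by rewrite mulr_ge0.
have [x Sx yx] := Sy _ e0.
have -> : f z - '[z, y] = (f z - '[z, x]) - '[z, y - x] by rewrite dotBr; ring.
apply: le_trans (ler_normB _ _) _.
rewrite mulrAC mulr_natl mulr2n mulrDl; apply: lerD => //.
apply: le_trans (dot_cauchy_schwarz _ _) _.
by rewrite mulrC ler_wpM2r.
Qed.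

(** Riesz representation in the second variable. It ensures that the choice in [op_of_form] does not
    fall back on 0 for the forms defining slices. *)
Lemma op_of_formP (B : H -> H -> C) (k : C) : near_minima C ->
  (forall c x y z, B (c *: x + y) z = c * B x z + B y z) ->
  (forall c x y z, B z (c *: x + y) = c^* * B z x + B z y) ->
  0 <= k -> (forall x y, `|B x y| <= k * `|x| * `|y|) ->
  [/\ linear (op_of_form B), norm_le (op_of_form B) k
    & forall x y, '[op_of_form B x, y] = B x y].
Proof.
move=> minC Bl Br k0 Bk.
have /choice[T TB] x : exists y, forall z, (B x z)^* = '[z, y].
  apply: (@riesz _ (k * `|x|)) => //.
    by move=> c y z; rewrite /= Br rmorphD rmorphM /= conjCK.
  by split=> [|z]; rewrite ?mulr_ge0 // norm_conjC.
have {}TB x y : '[T x, y] = B x y by rewrite dotC -TB conjCK.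
have TL : linear T.
  by move=> c x y; apply: dot_ext => z; rewrite dotDl dotZl !TB Bl.
have Tk : norm_le T k.
  split=> // x; have [->|Tx0] := eqVneq (T x) 0; first by rewrite normr0 mulr_ge0.
  (* Testing against [T x] bounds its squared norm by k |x| |T x|, and one factor cancels. *)
  have := Bk x (T x); rewrite -TB -hdot_norm normrX normr_id expr2.
  by rewrite ler_pM2r // normr_gt0.
by rewrite (@op_of_formE _ T) //; split=> //; exists k.
Qed.

End HilbertSpace.

(** * Normal functionals *)

Lemma series_limit_dist {C : numFieldType} (u : nat -> C) (l s e : C) (N : nat) :
  series u @ \oo --> l -> (forall n, (N <= n)%N -> `|series u n - s| <= e) ->
  `|l - s| <= e.
Proof.
move=> ul us; apply/ler_addgt0Pr => d d0.
have : \forall n \near \oo, ball l d (series u n) by exact: cvg_ball.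
have : \forall n \near \oo, (N <= n)%N by exact: nbhs_infty_ge.
move=> leN near_l; have [n [Nn ln]] := filter_ex (filterI leN near_l).
have -> : l - s = (series u n - s) + (l - series u n) by ring.
apply: le_trans (ler_normD _ _) _; apply: lerD (us _ Nn) _.
by move: ln; rewrite -ball_normE /= => /ltW.
Qed.


Section LinearCombinations.
Context {C : numClosedFieldType} {U W : normedModType C}.
Implicit Types X Y : U -> W.

Lemma norm_le_comb X Y b b' (c : C) :
  norm_le X b -> norm_le Y b' ->
  norm_le (fun x => c *: X x + Y x) (`|c| * b + b').
Proof.
move=> [b0 Xb] [b0' Yb']; split=> [|x]; first by rewrite addr_ge0 // mulr_ge0.
apply: le_trans (ler_normD _ _) _; rewrite mulrDl normrZ -mulrA.
by apply: lerD => //; rewrite ler_wpM2l.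
Qed.

Lemma linear_comb X Y (c : C) :
  linear X -> linear Y -> linear (fun x => c *: X x + Y x).
Proof.
move=> XL YL a x y; rewrite XL YL !scalerDr !scalerA mulrC !addrA.
by congr (_ + _); rewrite -!addrA; congr (_ + _); rewrite addrC.
Qed.

Lemma bounded_linear_comb X Y (c : C) :
  bounded_linear X -> bounded_linear Y ->
  bounded_linear (fun x => c *: X x + Y x).
Proof.
move=> [XL [b Xb]] [YL [b' Yb']]; split; first exact: linear_comb.
by exists (`|c| * b + b'); exact: norm_le_comb.
Qed.

End LinearCombinations.

Section NormalFunctionals.
Context {C : numClosedFieldType} {H : hilbertType C}.
Implicit Types (x y : H) (X Y : H -> H) (w : (H -> H) -> C).

(** The sum of squares is a crude bound for the product |x| |y|, but it can be summed directly for
    square-summable sequences. *)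
Lemma dot_op_le X b x y : norm_le X b ->
  `|'[X x, y]| <= b * (`|x| ^+ 2 + `|y| ^+ 2).
Proof.
move=> [b0 Xb]; apply: le_trans (dot_cauchy_schwarz _ _) _.
apply: (@le_trans _ _ (b * `|x| * `|y|)); first by rewrite ler_wpM2r.
rewrite -mulrA ler_wpM2l // -subr_ge0.
have -> : `|x| ^+ 2 + `|y| ^+ 2 - `|x| * `|y| = (`|x| - `|y|) ^+ 2 + `|x| * `|y|.
  by ring.
apply: addr_ge0; last exact: mulr_ge0.
by rewrite real_exprn_even_ge0 // rpredB // ger0_real.
Qed.

(* The truncation error is uniform on bounded sets of operators: the tails of
   the two square-summable series do not depend on the operator. *)
Lemma normal_approx w : near_minima C -> normal w ->
  exists x y : nat -> H, forall e, 0 < e -> exists N, forall X b,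
    linear X -> norm_le X b ->
    `|w X - \sum_(i < N) '[X (x i), y i]| <= e * b.
Proof.
move=> minC [x [y [[c xc] [d yd] wxy]]]; exists x, y => e e0.
pose t n := \sum_(i < n) (`|x i| ^+ 2 + `|y i| ^+ 2).
have t_le n : 0 <= (c + d) - t n.
  rewrite subr_ge0 /t big_split /=; apply: lerD; [exact: xc|exact: yd].
(* A near minimum of the remainder [c + d - t n] is an index after which the combined tail of the
   two series is at most [e]. *)
have [N tN] := minC nat _ e (inhabits 0%N) t_le e0.
exists N => X b XL Xb; have b0 := Xb.1.
apply: (@series_limit_dist _ _ _ _ _ N (wxy X _)); first by split=> //; exists b.
move=> n Nn; rewrite /series /= -(big_mkord xpredT (fun i => '[X (x i), y i])).
rewrite (big_cat_nat (leq0n N) Nn) /= [X in X - _]addrC addrK.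
apply: le_trans (ler_norm_sum _ _ _) _.
apply: (@le_trans _ _ (b * (t n - t N))).
  rewrite /t -!(big_mkord xpredT (fun i => `|x i| ^+ 2 + `|y i| ^+ 2)).
  rewrite (big_cat_nat (leq0n N) Nn) /= [X in X - _]addrC addrK mulr_sumr.
  by apply: ler_sum => i _; exact: dot_op_le.
rewrite mulrC ler_wpM2r // lerBlDl.
rewrite -subr_ge0; have := tN n; rewrite -subr_ge0.
by congr (is_true (0 <= _)); ring.
Qed.

Lemma normal_bound w : near_minima C -> normal w ->
  exists2 k, 0 <= k & forall X b, linear X -> norm_le X b -> `|w X| <= k * b.
Proof.
move=> minC /(normal_approx _ minC)[x [y wxy]].
have [N wN] := wxy 1 ltr01.
have S0 : 0 <= \sum_(i < N) (`|x i| ^+ 2 + `|y i| ^+ 2).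
  by apply: sumr_ge0 => i _; rewrite addr_ge0 ?exprn_ge0.
exists (1 + \sum_(i < N) (`|x i| ^+ 2 + `|y i| ^+ 2)) => [|X b XL Xb].
  by rewrite addr_ge0.
rewrite -[w X](subrK (\sum_(i < N) '[X (x i), y i])).
apply: le_trans (ler_normD _ _) _; rewrite mulrDl; apply: lerD; first exact: wN.
apply: le_trans (ler_norm_sum _ _ _) _; rewrite mulr_suml.
by apply: ler_sum => i _; rewrite mulrC; exact: dot_op_le.
Qed.

(** Truncations are exactly linear, and the uniform error lets a single index [N] serve [X], [Y] and
    their combination. *)
Lemma normal_linear w (c : C) X Y : near_minima C -> normal w ->
  bounded_linear X -> bounded_linear Y ->
  w (fun x => c *: X x + Y x) = c * w X + w Y.
Proof.
move=> minC /(normal_approx _ minC)[x [y wxy]] [XL [b Xb]] [YL [b' Yb']].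
apply/eqP; rewrite -subr_eq0 -normr_le0.
apply: (@le0_eps _ _ (2 * (`|c| * b + b'))) => [|e e0].
  by rewrite mulr_ge0 // addr_ge0 ?mulr_ge0 //; [exact: Xb.1|exact: Yb'.1].
have [N wN] := wxy e e0.
pose s Z := \sum_(i < N) '[Z (x i), y i].
have sD : s (fun x => c *: X x + Y x) = c * s X + s Y.
  rewrite /s mulr_sumr -big_split /=; apply: eq_bigr => i _.
  by rewrite dotDl dotZl.
have -> : w (fun x => c *: X x + Y x) - (c * w X + w Y)
    = (w (fun x => c *: X x + Y x) - s (fun x => c *: X x + Y x))
      - (c * (w X - s X) + (w Y - s Y)) by rewrite sD; ring.
apply: le_trans (ler_normB _ _) _.
have -> : 2 * (`|c| * b + b') * e = e * (`|c| * b + b') + e * (`|c| * b + b').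
  by ring.
apply: lerD.
  by apply: wN; [exact: linear_comb|exact: norm_le_comb].
apply: le_trans (ler_normD _ _) _; rewrite [leRHS]mulrDr; apply: lerD; last exact: wN.
by rewrite normrM mulrCA ler_wpM2l //; exact: wN.
Qed.

Lemma normal_vector x y : normal (fun X => '[X x, y]).
Proof.
have summ z : square_summable (fun n => if n is 0%N then z else 0 : H).
  exists (`|z| ^+ 2) => -[|n]; first by rewrite big_ord0 exprn_ge0.
  by rewrite big_ord_recl big1 ?addr0 // => i _; rewrite normr0 expr0n.
exists (fun n => if n is 0%N then x else 0), (fun n => if n is 0%N then y else 0).
(* The partial sum at index 0 is empty, so constancy is claimed from index 1 on. *)
split=> // T _; apply: cvg_near_cst; exists 1%N => // -[//|n] _.
rewrite /series /= big_mkord big_ord_recl big1 ?addr0 // => i _.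
by rewrite /= dot0r.
Qed.

End NormalFunctionals.

(** * C*-algebras *)

Section LinearProp.
Context {C : numClosedFieldType} {U W : lmodType C} (f : U -> W).
Hypothesis fL : linear f.

Lemma linear_propB x y : f (x - y) = f x - f y.
Proof. by rewrite -scaleN1r addrC fL scaleN1r addrC. Qed.

Lemma linear_prop0 : f 0 = 0.
Proof. by rewrite -[X in f X](subrr 0) linear_propB subrr. Qed.

Lemma linear_propZ c x : f (c *: x) = c *: f x.
Proof. by rewrite -[X in f X]addr0 fL linear_prop0 addr0. Qed.

End LinearProp.

(** Banach's fixed point theorem on a closed ball. Instead of iterating, the displacement |g y - y|
    is minimised approximately: one application of [g] multiplies it by at most [q]. *)
Lemma contraction_fixpoint {C : numClosedFieldType} {W : completeNormedModType C}
    (g : W -> W) (r q : C) : near_minima C ->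
  0 <= r -> 0 <= q < 1 ->
  (forall y, `|y| <= r -> `|g y| <= r) ->
  (forall y z, `|y| <= r -> `|z| <= r -> `|g y - g z| <= q * `|y - z|) ->
  exists2 y, `|y| <= r & g y = y.
Proof.
move=> minC r0 /andP[q0 q1] gr gq.
have p0 : 0 < 1 - q by rewrite subr_gt0.
pose S e := [set y | `|y| <= r /\ `|g y - y| <= (1 - q) * e].
have [||||y Sy] := @complete_approx C W S 2.
- by [].
- move=> e e0.
  pose X := {y : W | `|y| <= r}.
  have X0 : inhabited X by split; exists 0; rewrite normr0.
  pose F (y : X) := `|g (sval y) - sval y|.
  (* Comparing [y] with [g y] costs one factor [1 - q]; the other one remains in the definition of
     [S]. *)
  have [[y yr] yF] := minC X F ((1 - q) * ((1 - q) * e)) X0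
    (fun=> normr_ge0 _) (mulr_gt0 p0 (mulr_gt0 p0 e0)).
  exists y; split => //.
  rewrite -(ler_pM2l p0) mulrBl mul1r lerBlDl.
  have := yF (exist (fun z : W => `|z| <= r) (g y) (gr _ yr)); rewrite /F /= => /le_trans; apply.
  by rewrite lerD2r; apply: gq => //; exact: gr.
- move=> e x y e0 [xr xe] [yr ye].
  rewrite -(ler_pM2l p0) mulrBl mul1r lerBlDl.
  have -> : q * `|x - y| + (1 - q) * (2 * e)
    = (1 - q) * e + (q * `|x - y| + (1 - q) * e) by ring.
  have {1}-> : x - y = - (g x - x) + ((g x - g y) + (g y - y)).
    by rewrite opprB [X in _ = _ + X]addrA subrK addrA subrK.
  apply: le_trans (ler_normD _ _) _; rewrite normrN; apply: lerD => //.
  by apply: le_trans (ler_normD _ _) _; apply: lerD => //; exact: gq.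
- move=> e e' _ ee' x [xr xe]; split => //; apply: le_trans xe _.
  by rewrite ler_pM2l.
have yr : `|y| <= r.
  apply/ler_addgt0Pl => e e0; have [x [xr _] yx] := Sy _ e0.
  rewrite -[y](subrK x); apply: le_trans (ler_normD _ _) _; exact: lerD.
exists y => //; apply/eqP; rewrite -subr_eq0 -normr_le0.
apply: (@le0_eps _ _ 2) => // e e0; have [x [xr xe] yx] := Sy _ e0.
have -> : g y - y = (g y - g x) + ((g x - x) - (y - x)).
  by rewrite opprB [X in _ = _ + X]addrA subrK addrA subrK.
have -> : 2 * e = q * e + ((1 - q) * e + e) by ring.
apply: le_trans (ler_normD _ _) _; apply: lerD.
  by apply: le_trans (gq _ _ yr xr) _; rewrite ler_wpM2l.
by apply: le_trans (ler_normB _ _) _; exact: lerD.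
Qed.

Section CStarAlgebra.
Context {C : numClosedFieldType} {A : cstarAlgType C}.
Implicit Types a b h : A.

Lemma norm_star a : `|star a| = `|a|.
Proof.
have star_le b : `|b| <= `|star b|.
  have [->|b0] := eqVneq b 0; first by rewrite normr0.
  have := norm_submult (star b) b; rewrite cstar_identity expr2.
  by rewrite ler_pM2r // normr_gt0.
by apply/le_anti; rewrite star_le andbT; have := star_le (star a); rewrite starK.
Qed.

Lemma star_comb (c : C) a b : star (c *: a + b) = c^* *: star a + star b.
Proof. exact: star_antilinear. Qed.

Lemma starZ (c : C) a : star (c *: a) = c^* *: star a.
Proof.
have star0 : star (0 : A) = 0 by apply/eqP; rewrite -normr_eq0 norm_star normr0.
by rewrite -[X in star X]addr0 star_comb star0 addr0.
Qed.

Lemma starD a b : star (a + b) = star a + star b.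
Proof. by rewrite -[X in star (X + _)]scale1r star_comb conjC1 scale1r. Qed.

Lemma cmulBl a b d : cmul (a - b) d = cmul a d - cmul b d.
Proof. exact: (linear_propB _ (cmul_linearl d)). Qed.

Lemma cmulBr a b d : cmul d (a - b) = cmul d a - cmul d b.
Proof. exact: (linear_propB _ (cmul_linearr d)). Qed.

(* If y = (h + y^2) / 2 then (1 - y)^2 = 1 - h. *)
Lemma cstar_sqrt h : near_minima C -> star h = h -> `|h| < 1 ->
  exists2 b, star b = b & cmul b b = cone - h.
Proof.
move=> minC hs h1; pose r := `|h|.
pose g (y : A) := 2^-1 *: (h + cmul y y).
have norm2V : `|2^-1 : C| = 2^-1 by rewrite ger0_norm // invr_ge0.
have gr y : `|y| <= r -> `|g y| <= r.
  move=> yr; rewrite /g normrZ norm2V ler_pdivrMl // mulr_natl mulr2n.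
  apply: le_trans (ler_normD _ _) _; apply: lerD => //.
  apply: le_trans (norm_submult _ _) _; apply: le_trans (yr).
  by rewrite ler_piMl //; apply: le_trans yr (ltW h1).
have gq y z : `|y| <= r -> `|z| <= r -> `|g y - g z| <= r * `|y - z|.
  move=> yr zr; rewrite /g -scalerBr normrZ norm2V ler_pdivrMl // mulr_natl mulr2n.
  rewrite opprD addrACA subrr add0r.
  have -> : cmul y y - cmul z z = cmul y (y - z) + cmul (y - z) z.
    by rewrite cmulBl cmulBr addrA subrK.
  apply: le_trans (ler_normD _ _) _; apply: lerD; apply: le_trans (norm_submult _ _) _.
    by rewrite ler_wpM2r.
  by rewrite mulrC ler_wpM2r.
have r01 : 0 <= r < 1 by rewrite normr_ge0.
have [y yr gy] := contraction_fixpoint g r r minC (normr_ge0 h) r01 gr gq.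
(* As [h] is self-adjoint, [g] commutes with [star]; so [star y] is a fixed point in the same ball,
   and the contraction estimate identifies it with [y]. *)
have ys : star y = y.
  have gsy : g (star y) = star y.
    by rewrite -[in RHS]gy /g starZ starD starM hs conj_Creal.
  apply/eqP; rewrite -subr_eq0 -normr_eq0; apply/negPn/negP => yy.
  have := gq (star y) y; rewrite gsy gy norm_star => /(_ yr yr).
  rewrite ler_pMl; last by rewrite lt_def yy normr_ge0.
  by move=> /le_lt_trans/(_ h1); rewrite ltxx.
exists (cone - y).
  have star1 : star (cone : A) = cone.
    by rewrite -[star cone]cmul1r -[X in cmul _ X]starK -starM cmul1r starK.
  by rewrite -scaleN1r addrC star_comb star1 ys conj_Creal // rpredN rpred1.
rewrite cmulBl !cmulBr cmul1l cmul1r cmul1l.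
have hy : h = y + y - cmul y y.
  have : 2 *: y = h + cmul y y by rewrite -[in LHS]gy /g scalerA divff ?scale1r // pnatr_eq0.
  by rewrite scaler_nat mulr2n => ->; rewrite addrK.
by rewrite hy !opprD !opprK !addrA.
Qed.

(** For t > |a|^2 the element [cone - t^-1 *: cmul (star a) a] is the square of a self-adjoint [b].
    Hence 0 <= |rho b x|^2 = |x|^2 - |rho a x|^2 / t, and t may approach |a|^2. *)
Lemma cstar_rep_contractive (K : hilbertType C) (rho : A -> K -> K) :
  near_minima C ->
  (forall c a b x, rho (c *: a + b) x = c *: rho a x + rho b x) ->
  rho cone = id -> (forall a b, rho (cmul a b) = rho a \o rho b) ->
  (forall a, is_adjoint (rho a) (rho (star a))) ->
  forall a, norm_le (rho a) `|a|.
Proof.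
move=> minC rhoL rho1 rhoM rhoS a; split => // x.
have normr b : `|rho b x| ^+ 2 = '[rho (cmul (star b) b) x, x].
  by rewrite hdot_norm rhoM /= [RHS]rhoS starK.
rewrite -ler_sqr ?nnegrE ?mulr_ge0 // exprMn -subr_le0.
apply: (@le0_eps _ _ (`|x| ^+ 2)) => [|e e0]; first by rewrite exprn_ge0.
(* The summand [e] makes the norm of [t^-1 *: cmul (star a) a] strictly less than 1, as [cstar_sqrt]
   requires. *)
pose t := `|a| ^+ 2 + e.
have t0 : 0 < t by rewrite ltr_wpDl // exprn_ge0.
have tV : (t^-1)^* = t^-1 by rewrite conj_Creal // realV gtr0_real.
have [||b bs bb] := @cstar_sqrt (t^-1 *: cmul (star a) a) minC.
- by rewrite starZ starM starK tV.
- rewrite normrZ cstar_identity ger0_norm ?invr_ge0 ?ltW //.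
  by rewrite ltr_pdivrMl // mulr1 ltrDl.
have : 0 <= `|rho b x| ^+ 2 by rewrite exprn_ge0.
rewrite normr bs bb -scaleNr addrC rhoL rho1 dotDl dotZl -normr -hdot_norm.
rewrite mulNr addrC subr_ge0 ler_pdivrMl // => rho_le.
by rewrite lerBlDl [`|x| ^+ 2 * e]mulrC -mulrDl.
Qed.

End CStarAlgebra.

(** * Slice maps *)

Section FlipTensor.
Context {C : numClosedFieldType} {K H : hilbertType C} (T : hilbert_tensor K H).

Lemma flip_tensor_dot (h h' : H) (k k' : K) :
  '[ht_map (h := T) k h, ht_map k' h'] = '[h, h'] * '[k, k'].
Proof. by rewrite ht_dot mulrC. Qed.

Lemma flip_tensor_dense :
  dense [set t : T | exists n (h : 'I_n -> H) (k : 'I_n -> K),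
                       t = \sum_(i < n) ht_map (k i) (h i)].
Proof.
move=> O O0 Oo; have [t [Ot [n [k [h tE]]]]] := @ht_dense _ _ _ T O O0 Oo.
by exists t; split => //; exists n, h, k.
Qed.

(** The same space with its factors exchanged. Left and right slices swap by conversion, so slice
    properties proved on one side transfer to the other. *)
Definition flip_tensor : hilbert_tensor H K :=
  @Build_hilbert_tensor C H K T (fun h k => ht_map k h)
    (@ht_linearr C K H T) (@ht_linearl C K H T)
    flip_tensor_dot flip_tensor_dense.

End FlipTensor.

(** * Vector slices and slices by normal functionals *)

Section VectorSlices.
Context {C : numClosedFieldType} {K H : hilbertType C} {T : hilbert_tensor K H}.
Hypothesis minC : near_minima C.
Implicit Types (V : T -> T) (k : K) (h : H).

Lemma ht_norm k h : `|ht_map (h := T) k h| = `|k| * `|h|.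
Proof.
apply/eqP; rewrite -(@eqrXn2 _ 2) ?mulr_ge0 //.
by rewrite exprMn !hdot_norm ht_dot.
Qed.

(** The difference [d] is orthogonal to all sums of elementary tensors, and these come arbitrarily
    close to [d] itself. *)
Lemma tensor_ext (s t : T) :
  (forall k h, '[s, ht_map k h] = '[t, ht_map k h]) -> s = t.
Proof.
move=> st; pose d := s - t.
have dS n (k : 'I_n -> K) (h : 'I_n -> H) : '[d, \sum_(i < n) ht_map (k i) (h i)] = 0.
  rewrite (big_morph (hdot d) (fun x y => dotDr x y d) (dot0r d)) big1 // => i _.
  by rewrite /d dotBl st subrr.
apply/eqP; rewrite -subr_eq0 -normr_le0 -/d.
apply: (@le0_eps _ _ 1) => // e e0; rewrite mul1r.
have [|u [du [n [k [h uE]]]]] := @ht_dense _ _ _ T (ball d e) _ (ball_open d e).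
  by exists d; exact: ballxx.
have [->|d0] := eqVneq d 0; first by rewrite normr0 ltW.
rewrite -(@ler_pM2r _ `|d|) ?normr_gt0 // -expr2 hdot_norm.
have -> : '[d, d] = '[d - u, d].
  by rewrite dotBl [X in _ - X]dotC uE dS conjC0 subr0.
have dd : 0 <= '[d, d] by exact: dnorm_ge0.
have {1}-> : '[d - u, d] = `|'[d - u, d]|.
  by rewrite ger0_norm // dotBl [X in _ - X]dotC uE dS conjC0 subr0.
apply: le_trans (dot_cauchy_schwarz _ _) _.
by rewrite ler_wpM2r //; move: du; rewrite -ball_normE => /ltW.
Qed.

Lemma vec_slice_rP V v h h' : linear V -> norm_le V v ->
  [/\ linear (vec_slice_r V h h'), norm_le (vec_slice_r V h h') (v * `|h| * `|h'|)
    & forall k k', '[vec_slice_r V h h' k, k'] = '[V (ht_map k h), ht_map k' h']].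
Proof.
move=> VL [v0 Vv]; apply: op_of_formP => //.
- by move=> c x y z; rewrite ht_linearl VL dotDl dotZl.
- by move=> c x y z; rewrite ht_linearl dotDr dotZr.
- by rewrite !mulr_ge0.
move=> x y; apply: le_trans (dot_cauchy_schwarz _ _) _.
have -> : v * `|h| * `|h'| * `|x| * `|y| = (v * (`|x| * `|h|)) * (`|y| * `|h'|) by ring.
by rewrite -!ht_norm ler_wpM2r.
Qed.

End VectorSlices.

Section RightSlices.
Context {C : numClosedFieldType} {K H : hilbertType C} {T : hilbert_tensor K H}.
Hypothesis minC : near_minima C.
Implicit Types (V : T -> T) (k : K) (h : H).

Lemma vec_slice_lP V v k k' : linear V -> norm_le V v ->
  [/\ linear (vec_slice_l V k k'), norm_le (vec_slice_l V k k') (v * `|k| * `|k'|)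
    & forall h h', '[vec_slice_l V k k' h, h'] = '[V (ht_map k h), ht_map k' h']].
Proof. exact: (@vec_slice_rP C H K (flip_tensor T) minC). Qed.

Lemma vec_slice_lE V k k' h h' : bounded_linear V ->
  '[vec_slice_l V k k' h, h'] = '[V (ht_map k h), ht_map k' h'].
Proof. by move=> [VL [v Vv]]; have [_ _ ->] := vec_slice_lP _ _ k k' VL Vv. Qed.

Lemma bounded_vec_slice_l V k k' : bounded_linear V ->
  bounded_linear (vec_slice_l V k k').
Proof.
move=> [VL [v Vv]]; have [sL sv _] := vec_slice_lP _ _ k k' VL Vv.
by split=> //; exists (v * `|k| * `|k'|).
Qed.

(** The constant depends on [w] only; the boundedness of convolution products rests on this
    uniformity in [V]. *)
Lemma slice_rP w : normal w -> exists2 b, 0 <= b &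
  forall V v, linear V -> norm_le V v ->
  [/\ linear (slice_r w V), norm_le (slice_r w V) (b * v)
    & forall k k', '[slice_r w V k, k'] = w (vec_slice_l V k k')].
Proof.
move=> nw; have [b b0 wb] := normal_bound _ minC nw.
exists b => // V v VL Vv.
have Vbl : bounded_linear V by split=> //; exists v.
apply: op_of_formP => //.
- move=> c x y z; rewrite -(normal_linear _ _ _ _ minC nw); try exact: bounded_vec_slice_l.
  congr w; apply: op_ext => h h'.
  by rewrite dotDl dotZl !vec_slice_lE // ht_linearl Vbl.1 dotDl dotZl.
- move=> c x y z; rewrite -(normal_linear _ _ _ _ minC nw); try exact: bounded_vec_slice_l.
  congr w; apply: op_ext => h h'.
  by rewrite dotDl dotZl !vec_slice_lE // ht_linearl dotDr dotZr.
- by rewrite mulr_ge0 //; exact: Vv.1.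
move=> x y; have [sL sv _] := vec_slice_lP _ _ x y VL Vv.
by apply: le_trans (wb _ _ sL sv) _; rewrite !mulrA.
Qed.

Lemma slice_rE w V k k' : normal w -> bounded_linear V ->
  '[slice_r w V k, k'] = w (vec_slice_l V k k').
Proof.
by move=> /slice_rP[b _ wP] [VL [v Vv]]; have [_ _ ->] := wP V v VL Vv.
Qed.

Lemma bounded_slice_r w V : normal w -> bounded_linear V ->
  bounded_linear (slice_r w V).
Proof.
move=> /slice_rP[b _ wP] [VL [v Vv]]; have [sL sv _] := wP V v VL Vv.
by split=> //; exists (b * v).
Qed.

Lemma slice_r_comb w c V V' : normal w -> bounded_linear V -> bounded_linear V' ->
  slice_r w (fun t => c *: V t + V' t)
  = (fun k => c *: slice_r w V k + slice_r w V' k).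
Proof.
move=> nw bV bV'; have bVV' := bounded_linear_comb _ _ c bV bV'.
apply: op_ext => k k'; rewrite dotDl dotZl !slice_rE //.
rewrite -(normal_linear _ _ _ _ minC nw); try exact: bounded_vec_slice_l.
congr w; apply: op_ext => h h'.
by rewrite dotDl dotZl !vec_slice_lE // dotDl dotZl.
Qed.

End RightSlices.

Section LeftSlices.
Context {C : numClosedFieldType} {K H : hilbertType C} {T : hilbert_tensor K H}.
Hypothesis minC : near_minima C.
Implicit Types (V : T -> T) (k : K) (h : H).

Lemma vec_slice_rE V k k' h h' : bounded_linear V ->
  '[vec_slice_r V h h' k, k'] = '[V (ht_map k h), ht_map k' h'].
Proof. exact: (@vec_slice_lE C H K (flip_tensor T) minC). Qed.

Lemma bounded_vec_slice_r V h h' : bounded_linear V ->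
  bounded_linear (vec_slice_r V h h').
Proof. exact: (@bounded_vec_slice_l C H K (flip_tensor T) minC). Qed.

Lemma slice_lE w V h h' : normal w -> bounded_linear V ->
  '[slice_l w V h, h'] = w (vec_slice_r V h h').
Proof. exact: (@slice_rE C H K (flip_tensor T) minC). Qed.

Lemma bounded_slice_l w V : normal w -> bounded_linear V ->
  bounded_linear (slice_l w V).
Proof. exact: (@bounded_slice_r C H K (flip_tensor T) minC). Qed.

Lemma slice_r_vector V h h' : bounded_linear V ->
  slice_r (fun X => '[X h, h']) V = vec_slice_r V h h'.
Proof.
move=> bV; apply: op_ext => k k'; rewrite vec_slice_rE // slice_rE //.
  by rewrite vec_slice_lE.
exact: normal_vector.
Qed.

(* Norm convergence replaces Fubini for the double series obtained by applying
   a second normal functional to the slice. *)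
Lemma slice_approx w : normal w ->
  exists u v : nat -> H, forall V b, linear V -> norm_le V b -> forall e, 0 < e ->
  exists N, norm_le (fun k => slice_r w V k
                      - \sum_(i < N) vec_slice_r V (u i) (v i) k) (e * b).
Proof.
move=> nw; have [u [v uv]] := normal_approx _ minC nw.
exists u, v => V b VL Vb e e0; have [N wN] := uv e e0; exists N.
have bV : bounded_linear V by split=> //; exists b.
have eb0 : 0 <= e * b by apply: mulr_ge0; [exact: ltW|exact: Vb.1].
split=> // k; set z := _ - _.
have [->|z0] := eqVneq z 0; first by rewrite normr0 mulr_ge0.
(* Pairing the error [z] with itself gives the truncation error of [w] at the vector slice for [k]
   and [z], whose norm is at most b |k| |z|. *)
suff : `|z| ^+ 2 <= e * b * `|k| * `|z| by rewrite expr2 ler_pM2r // normr_gt0.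
have [sL sb _] := vec_slice_lP minC _ _ k z VL Vb.
have zz : '[z, z] = w (vec_slice_l V k z)
    - \sum_(i < N) '[vec_slice_l V k z (u i), v i].
  rewrite {1}/z dotBl slice_rE //; congr (_ - _).
  rewrite (big_morph (hdot^~ z) (fun x y => dotDl x y z) (dot0l z)).
  by apply: eq_bigr => i _; rewrite vec_slice_rE // vec_slice_lE.
rewrite hdot_norm -[leLHS]ger0_norm ?dnorm_ge0 // zz.
by apply: le_trans (wN _ _ sL sb) _; rewrite !mulrA.
Qed.

End LeftSlices.

(** * Eberlein algebras *)

(** As [V] fixes [x], comparing norms at [x + t *: y] leaves a nonnegative quadratic in [t] without
    constant term, so its linear coefficient ['[y, x] - '[V y, x]] vanishes. *)
Lemma contraction_fixed_dot {C : numClosedFieldType} {H : hilbertType C}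
    (V : H -> H) (x : H) :
  linear V -> norm_le V 1 -> V x = x -> forall y, '[V y, x] = '[y, x].
Proof.
move=> VL [_ V1] Vx y; apply/eqP; rewrite eq_sym -subr_eq0 -normr_eq0 -sqrf_eq0.
rewrite -normr_le0 normrX normr_id -[leRHS](mul0r (`|y| ^+ 2)).
apply: quadratic_discriminant => [|t]; first by rewrite exprn_ge0.
have : `|V (x + t *: y)| ^+ 2 <= `|x + t *: y| ^+ 2.
  by rewrite ler_sqr ?nnegrE // -[leRHS]mul1r.
have -> : V (x + t *: y) = x + t *: V y by rewrite addrC VL Vx addrC.
rewrite !dot_normD !dotZl !normrZ !exprMn -subr_ge0 => h1.
have h2 : 0 <= `|t| ^+ 2 * `|V y| ^+ 2 by rewrite mulr_ge0 ?exprn_ge0.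
by have := addr_ge0 h1 h2; congr (is_true (0 <= _)); ring.
Qed.

Lemma normal_sub_sum {C : numClosedFieldType} {H : hilbertType C}
    (w : (H -> H) -> C) (X : H -> H) (Y : nat -> H -> H) (n : nat) :
  near_minima C -> normal w -> bounded_linear X ->
  (forall i, bounded_linear (Y i)) ->
  bounded_linear (fun x => X x - \sum_(i < n) Y i x) /\
  w (fun x => X x - \sum_(i < n) Y i x) = w X - \sum_(i < n) w (Y i).
Proof.
move=> minC nw bX bY; elim: n => [|n [IHb IHw]].
  have -> : (fun x => X x - \sum_(i < 0) Y i x) = X.
    by apply/funext => x; rewrite big_ord0 subr0.
  by rewrite big_ord0 subr0.
have -> : (fun x => X x - \sum_(i < n.+1) Y i x)
    = (fun x => -1 *: Y n x + (X x - \sum_(i < n) Y i x)).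
  by apply/funext => x; rewrite big_ord_recr /= opprD addrA scaleN1r addrC.
split; first exact: bounded_linear_comb.
rewrite (normal_linear _ _ _ _ minC nw) // IHw big_ord_recr /=; ring.
Qed.

(** * Functionals on [A] and their normal extensions *)

Section Bidual.
Context {C : numClosedFieldType} {A : cstarAlgType C} {B : bidual_vN A}.
Hypothesis minC : near_minima C.

(** By [bd_onto] the choice in [bd_ext] has a candidate, so its default value is not taken on the
    dual. *)
Lemma bd_extP (mu : A -> C) : dual A mu ->
  normal (bd_ext (B := B) mu) /\ forall a, bd_ext (B := B) mu (bd_rep a) = mu a.
Proof.
move=> dmu; have [w nw wmu] := @bd_onto _ _ B mu dmu.
exact: (@xgetPex _ (fun=> 0)
  [set w : (B -> B) -> C | normal w /\ forall a, w (bd_rep a) = mu a]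
  (ex_intro _ w (conj nw wmu))).
Qed.

Definition vector_functional (k k' : B) (a : A) : C := '[bd_rep a k, k'].

(** [bd_bounded] gives each operator its own bound; a bound proportional to |a| comes from
    [cstar_rep_contractive]. *)
Lemma dual_vector_functional k k' : dual A (vector_functional k k').
Proof.
split=> [c a b|]; first by rewrite /vector_functional bd_linear dotDl dotZl.
exists (`|k| * `|k'|); split=> [|a]; first by rewrite mulr_ge0.
have [_ rep_le] := cstar_rep_contractive B (@bd_rep _ _ B) minC (@bd_linear _ _ B)
  (@bd_1 _ _ B) (@bd_M _ _ B) (@bd_star _ _ B) a.
apply: le_trans (dot_cauchy_schwarz _ _) _.
have -> : `|k| * `|k'| * `|a| = `|a| * `|k| * `|k'| by ring.
exact: ler_wpM2r.
Qed.

Lemma state_vector_functional k : `|k| = 1 -> state (vector_functional k k).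
Proof.
move=> k1; split; first exact: dual_vector_functional.
  move=> a; rewrite /vector_functional bd_M /=.
  have := @bd_star _ _ B (star a) (bd_rep a k) k; rewrite starK => ->.
  exact: dnorm_ge0.
by rewrite /vector_functional bd_1 -hdot_norm k1 expr1n.
Qed.

Lemma bd_rep_scalar (c : C) : bd_rep (b := B) (c *: (cone : A)) = fun k => c *: k.
Proof.
apply/funext => k; have rep0 : bd_rep (b := B) (0 : A) k = 0.
  have := @bd_linear _ _ B (-1) 0 0 k.
  by rewrite scaler0 addr0 scaleN1r addNr.
by rewrite -[X in bd_rep X]addr0 bd_linear rep0 addr0 bd_1.
Qed.

End Bidual.

(** * Slices of [V], invariant vectors and invariant means *)

Section Eberlein.
Context {C : numClosedFieldType} {A : cstarAlgType C} {H : hilbertType C}.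
Context {B : bidual_vN A} {T2 : hilbert_tensor B B} {T : hilbert_tensor B H}.
Context {Phi : A -> T2 -> T2} {V : T -> T}.
Hypothesis minC : near_minima C.
Hypothesis hE : cstar_eberlein Phi V.
Implicit Types (mu nu M : A -> C) (h x y : H) (k : B).

Let bV : bounded_linear V := (V_in hE).1.

(** This puts the vector slices in the image of [A], where the normal extension of a functional has
    prescribed values. *)
Lemma vec_slice_rep h h' : exists a, bd_rep a = vec_slice_r V h h'.
Proof.
have [a aV] := AV_sub hE (normal_vector h h').
by exists a; rewrite aV slice_r_vector.
Qed.

Lemma mu_sliceE mu h h' : dual A mu ->
  '[mu_slice V mu h, h'] = bd_ext (B := B) mu (vec_slice_r V h h').
Proof. by move=> /(@bd_extP _ _ B)[nw _]; exact: slice_lE. Qed.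

Lemma bounded_mu_slice mu : dual A mu -> bounded_linear (mu_slice V mu).
Proof. by move=> /(@bd_extP _ _ B)[nw _]; exact: bounded_slice_l. Qed.

Lemma mu_slice_vector k k' h h' :
  '[mu_slice V (vector_functional k k') h, h'] = '[V (ht_map k h), ht_map k' h'].
Proof.
have dk := dual_vector_functional minC k k'.
have [a aV] := vec_slice_rep h h'.
by rewrite mu_sliceE // -aV (bd_extP _ dk).2 /vector_functional aV vec_slice_rE.
Qed.

(** The vector slice at [h] and [h'] is the scalar [c], the image of [c *: cone]. This applies when
    [h] is fixed and, through the adjoint of [V], when [h'] is. *)
Lemma mu_slice_scalar mu (c : C) h h' : dual A mu ->
  (forall k k', '[V (ht_map k h), ht_map k' h'] = c * '[k, k']) ->
  '[mu_slice V mu h, h'] = c * mu cone.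
Proof.
move=> dmu Vc; rewrite mu_sliceE //.
have -> : vec_slice_r V h h' = bd_rep (c *: cone).
  by apply: op_ext => k k'; rewrite vec_slice_rE // Vc bd_rep_scalar dotZl.
by rewrite (bd_extP _ dmu).2 (linear_propZ _ dmu.1).
Qed.

Definition fixed_vector h : Prop := forall k, V (ht_map k h) = ht_map k h.

(** Forwards, vector functionals already determine [V] on elementary tensors; backwards, the vector
    slices at a fixed vector are scalars. *)
Lemma invariant_fixedP h : invariant_vectors V h <-> fixed_vector h.
Proof.
split=> [hI k|hF mu dmu].
  apply: tensor_ext => k' h'.
  rewrite -mu_slice_vector (hI _ (dual_vector_functional minC k k')) dotZl ht_dot.
  by rewrite /vector_functional bd_1.
apply: dot_ext => h'; rewrite dotZl mulrC; apply: mu_slice_scalar => // k k'.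
by rewrite hF ht_dot mulrC.
Qed.

Lemma mu_slice_dot_fixed mu h x : dual A mu -> fixed_vector x ->
  '[mu_slice V mu h, x] = '[h, x] * mu cone.
Proof.
move=> dmu xF; apply: mu_slice_scalar => // k k'.
by rewrite (contraction_fixed_dot _ _ bV.1 (V_contraction hE) (xF k')) ht_dot mulrC.
Qed.

Lemma mean_slice_fixed M h : left_invariant_mean Phi M ->
  fixed_vector (mu_slice V M h).
Proof.
move=> [[dM _ _] Minv]; set x := mu_slice V M h.
(* The vector state at [k] convolved with [M] is [M], so by multiplicativity its slice fixes [x];
   the matrix coefficients of that slice are those of [V]. *)
have unitV k h' : `|k| = 1 -> '[V (ht_map k x), ht_map k h'] = '[x, h'].
  move=> k1; have sk := state_vector_functional minC k k1.
  have convM : Defs.conv Phi (vector_functional k k) M = M.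
    by apply/funext => a; exact: (Minv _ a sk).
  have dk := dual_vector_functional minC k k.
  by rewrite -mu_slice_vector /x -[mu_slice _ _ (mu_slice _ _ _)]/((_ \o _) h)
    -(V_hom hE) // convM.
have [VL _] := bV.
move=> k; apply: tensor_ext => k' h'; apply/eqP; rewrite -subr_eq0; apply/eqP.
move: k k'; apply: (dot_polarization (fun k k' =>
  '[V (ht_map k x), ht_map k' h'] - '[ht_map k x, ht_map k' h'])).
- by move=> c k k' z; rewrite ht_linearl VL !dotDl !dotZl; ring.
- by move=> c k k' z; rewrite ht_linearl !dotDr !dotZr; ring.
move=> k; have [->|k0] := eqVneq k 0.
  by rewrite (linear_prop0 _ (ht_linearl T h')) !dot0r subrr.
(* Normalise, since the vector functional of [k] with itself is a state only for unit vectors. *)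
have [u [c [u1 ->]]] : exists u : B, exists c : C, `|u| = 1 /\ k = c *: u.
  exists (`|k|^-1 *: k), `|k|; split.
    by rewrite normrZ normfV normr_id mulVf // normr_eq0.
  by rewrite scalerA divff ?scale1r // normr_eq0.
have htZ z : ht_map (h := T) (c *: u) z = c *: ht_map u z.
  exact: linear_propZ _ (ht_linearl T z) c u.
rewrite !htZ (linear_propZ _ VL) !dotZl !dotZr.
by rewrite unitV // ht_dot -hdot_norm u1 expr1n mul1r subrr.
Qed.

Lemma mean_slice_invariant M h : left_invariant_mean Phi M ->
  invariant_vectors V (mu_slice V M h).
Proof. by move=> hM; apply/invariant_fixedP; exact: mean_slice_fixed. Qed.

(** The case [mu = M] is idempotence; taking another mean for [mu] leads to uniqueness. *)
Lemma mean_slice_absorb M mu : left_invariant_mean Phi M -> dual A mu ->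
  mu cone = 1 -> mu_slice V mu \o mu_slice V M = mu_slice V M.
Proof.
move=> hM dmu mu1; apply/funext => h /=.
by rewrite (mean_slice_invariant _ h hM _ dmu) mu1 scale1r.
Qed.

(** With P the slice of [M], the vector P y is fixed, so <P x, P y> = <x, P y>. The left side is
    hermitian in x and y, hence so is the right side. *)
Lemma mean_slice_adjoint M : left_invariant_mean Phi M ->
  is_adjoint (mu_slice V M) (mu_slice V M).
Proof.
move=> hM; have [[dM _ M1] _] := hM.
have PP x y : '[mu_slice V M x, mu_slice V M y] = '[x, mu_slice V M y].
  by rewrite mu_slice_dot_fixed // ?M1 ?mulr1 //; exact: mean_slice_fixed.
by move=> x y; rewrite -PP dotC -(PP y x) -dotC.
Qed.

Lemma mean_slice_projection M : left_invariant_mean Phi M ->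
  orthogonal_projection_onto (mu_slice V M) (invariant_vectors V).
Proof.
move=> hM; have [[dM _ M1] _] := hM; split.
- exact: bounded_mu_slice.
- exact: mean_slice_absorb.
- exact: mean_slice_adjoint.
apply/seteqP; split=> [_ [h _ <-]|h hI]; first exact: mean_slice_invariant.
by exists h => //; rewrite hI // M1 scale1r.
Qed.

(** The slice of [V] by [mu] only records values of [mu] at vector slices, but finite sums of these
    approximate [slice_r w V] in norm, and normal functionals are norm-bounded. *)
Lemma mu_slice_eq_on_AV mu nu a (w : (H -> H) -> C) :
  dual A mu -> dual A nu -> mu_slice V mu = mu_slice V nu ->
  normal w -> bd_rep (b := B) a = slice_r w V -> mu a = nu a.
Proof.
move=> dmu dnu mn nw aV.
have [nmu muE] := bd_extP (B := B) _ dmu; have [nnu nuE] := bd_extP (B := B) _ dnu.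
rewrite -muE -nuE aV.
have [u [v uv]] := slice_approx (T := T) minC _ nw.
have [b b0 bmu] := normal_bound _ minC nmu.
have [b' b0' bnu] := normal_bound _ minC nnu.
apply/eqP; rewrite -subr_eq0 -normr_le0.
apply: (@le0_eps _ _ (b + b')) => [|e e0]; first exact: addr_ge0.
have [N] := uv V 1 bV.1 (V_contraction hE) e e0; rewrite mulr1.
set X := fun k : B => _ => XN.
have bs i : bounded_linear (vec_slice_r V (u i) (v i)) by exact: bounded_vec_slice_r.
have bw : bounded_linear (slice_r w V) by exact: bounded_slice_r.
have [bX muX] := normal_sub_sum _ _ _ N minC nmu bw bs.
have [_ nuX] := normal_sub_sum _ _ _ N minC nnu bw bs.
(* The finite sums contribute equally to both functionals, which leaves the error operator [X], of
   norm at most [e]. *)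
have -> : bd_ext mu (slice_r w V) - bd_ext nu (slice_r w V)
    = bd_ext (B := B) mu X - bd_ext (B := B) nu X.
  rewrite muX nuX.
  have -> : \sum_(i < N) bd_ext mu (vec_slice_r V (u i) (v i))
      = \sum_(i < N) bd_ext nu (vec_slice_r V (u i) (v i)).
    by apply: eq_bigr => i _; rewrite -!mu_sliceE // mn.
  by ring.
apply: le_trans (ler_normB _ _) _; rewrite mulrDl.
by apply: lerD; [exact: bmu bX.1 XN|exact: bnu bX.1 XN].
Qed.

Lemma mu_slice_inj mu nu : dual A mu -> dual A nu ->
  mu_slice V mu = mu_slice V nu -> mu = nu.
Proof.
move=> dmu dnu mn; apply/funext => a.
have [muL [b [b0 bmu]]] := dmu; have [nuL [b' [b0' bnu]]] := dnu.
apply/eqP; rewrite -subr_eq0 -normr_le0.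
apply: (@le0_eps _ _ (b + b')) => [|e e0]; first exact: addr_ge0.
have [|a' [aa' [w nw a'V]]] := @AV_dense _ _ _ _ _ _ _ _ hE (ball a e) _ (ball_open a e).
  by exists a; exact: ballxx.
have -> : mu a - nu a = mu (a - a') - nu (a - a').
  rewrite (linear_propB _ muL) (linear_propB _ nuL).
  by rewrite (mu_slice_eq_on_AV mu nu a' w dmu dnu mn nw a'V); ring.
have ae : `|a - a'| <= e by move: aa'; rewrite -ball_normE => /ltW.
apply: le_trans (ler_normB _ _) _; rewrite mulrDl.
by apply: lerD; [apply: le_trans (bmu _) _|apply: le_trans (bnu _) _];
  rewrite ler_wpM2l.
Qed.

Lemma dual_conv mu nu : dual A mu -> dual A nu -> dual A (Defs.conv Phi mu nu).
Proof.
move=> /(@bd_extP _ _ B)[nmu _] /(@bd_extP _ _ B)[nnu _].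
have bPhi a : bounded_linear (Phi a) := (Phi_in hE a).1.
split=> [c a b|].
  rewrite /Defs.conv /pair_tensor.
  have -> : Phi (c *: a + b) = (fun t => c *: Phi a t + Phi b t).
    by apply/funext => t; exact: (Phi_linear hE).
  rewrite slice_r_comb //.
  by rewrite (normal_linear _ _ _ _ minC nmu) //; exact: bounded_slice_r.
have [b b0 bmu] := normal_bound _ minC nmu.
have [b' b0' bnu] := slice_rP (K := B) (T := T2) minC _ nnu.
exists (b * b'); split=> [|a]; first exact: mulr_ge0.
(* [Phi] is itself a unital *-representation on [T2], hence contractive. *)
have Phi_le := cstar_rep_contractive T2 Phi minC (Phi_linear hE) (Phi_1 hE)
  (Phi_M hE) (Phi_star hE) a.
have [sL sb _] := bnu (Phi a) _ (bPhi a).1 Phi_le.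
by rewrite -mulrA; exact: bmu sL sb.
Qed.

(** With P and Q the slices of [M] and [M'], absorption gives P Q = Q and Q P = P. Both are
    self-adjoint, so the adjoint of the first identity reads Q = Q P = P. *)
Lemma left_invariant_mean_unique M M' :
  left_invariant_mean Phi M -> left_invariant_mean Phi M' -> M' = M.
Proof.
move=> hM hM'; have [[dM _ M1] _] := hM; have [[dM' _ M'1] _] := hM'.
apply: mu_slice_inj => //; apply: op_ext => x y.
rewrite -[in LHS](mean_slice_absorb M' M hM' dM M1) /= mean_slice_adjoint //.
rewrite mean_slice_adjoint // -[mu_slice V M' _]/((_ \o _) y).
by rewrite mean_slice_absorb // -mean_slice_adjoint.
Qed.

(** With P and U the slices of [M] and [mu], the convolution has slice P U. As P y is fixed and [mu]
    is a state, <P U x, y> = <U x, P y> = <x, P y> = <P x, y>, so this slice is P. *)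
Lemma left_invariant_mean_right M :
  left_invariant_mean Phi M -> right_invariant_mean Phi M.
Proof.
move=> hM; have [sM _] := hM; have [dM _ M1] := sM.
split=> // mu a [dmu _ mu1]; rewrite /act_l /bd_ev.
suff -> : Defs.conv Phi M mu = M by [].
apply: mu_slice_inj => //; first exact: dual_conv.
apply: op_ext => x y; rewrite (V_hom hE) //= mean_slice_adjoint //.
rewrite mu_slice_dot_fixed ?mu1 ?mulr1 ?mean_slice_adjoint //.
exact: mean_slice_fixed.
Qed.

End Eberlein.

Theorem theorem4p7 (R : realType) (A : cstarAlgType R[i]) (H : hilbertType R[i])
    (B : bidual_vN A) (T2 : hilbert_tensor B B) (T : hilbert_tensor B H)
    (Phi : A -> T2 -> T2) (V : T -> T)
    (hE : cstar_eberlein Phi V)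
    (M : A -> R[i]) (hM : left_invariant_mean Phi M) :
  [/\ forall M' : A -> R[i], left_invariant_mean Phi M' -> M' = M,
      orthogonal_projection_onto (mu_slice V M) (invariant_vectors V)
    & unitary V -> right_invariant_mean Phi M].
Proof.
have minC := complex_near_minima R.
split=> [M' hM'||_].
- exact: (left_invariant_mean_unique minC hE).
- exact: (mean_slice_projection minC hE).
- exact: (left_invariant_mean_right minC hE).
Qed.
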